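(* Fix integers $m,n\ge 2$ and let $$\mathcal{W}_{m,n}(\mathbb{Z};H)=\{A_1A_2\cdots A_m : A_1,\dots,A_m\in\mathcal{M}_n(\mathbb{Z};H)\}.$$ Then, as $H\to\infty$, $$\#\mathcal{W}_{m,n}(\mathbb{Z};H)\ge H^{n^2+mn-n+o(1)}.$$ Moreover, if $m\ge 6$, then $\#\mathcal{W}_{m,n}(\mathbb{Z};H)=o(H^{mn^2})$ as $H\to\infty$.
   Context: For positive integers $n,H$, $\mathcal{M}_n(\mathbb{Z};H)$ denotes the set of $n\times n$ integer matrices $(a_{ij})$ with $|a_{ij}|\le H$ for all $i,j$. A bound $X\ge H^{c+o(1)}$ means: for every $\varepsilon>0$, $X\ge H^{c-\varepsilon}$ for all sufficiently large $H$. $U(H)=o(V(H))$ means $U(H)/V(H)\to 0$ as $H\to\infty$. *)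

(* Defs.v *)
From Stdlib Require Import Reals.
From mathcomp Require Import all_boot all_order all_algebra.
Set Implicit Arguments. Unset Strict Implicit. Unset Printing Implicit Defensive.

(* Entry coding: k : 'I_(2H+1) represents the integer k - H, so the map below
   is a bijection from 'M['I_(2H+1)]_n onto M_n(Z;H). *)
Definition entry_of (H : nat) (k : 'I_(H.*2.+1)) : int := (Posz k - Posz H)%R.

Definition mat_of (n H : nat) (M : 'M['I_(H.*2.+1)]_n) : 'M[int]_n :=
  map_mx (@entry_of H) M.

Definition prod_word (n m : nat) (A : 'I_m -> 'M[int]_n) : 'M[int]_n :=
  foldr (fun B C => (B *m C)%R) (1%:M)%R [seq A i | i <- enum 'I_m].

Definition words (m n H : nat) : seq 'M[int]_n :=
  [seq prod_word (fun i => mat_of (f i)) | f : {ffun 'I_m -> 'M['I_(H.*2.+1)]_n}].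

Definition cardW (m n H : nat) : nat := size (undup (words m n H)).

(* Main.v *)
Require Import Defs.
From Stdlib Require Import Reals Lra.
From mathcomp Require Import all_boot all_order all_algebra.
From mathcomp Require Import zify ring lra.

(** Lower bound.  Take words A D_2 ... D_m with the entries of A and the diagonal
    entries of the diagonal matrices D_l in [1, H]: there are
    H^(n^2 + (m-1)n) of them.  Every diagonal entry in column j divides the
    nonzero entry (0, j) of the product, and the product together with the D_l
    determines A, so by the divisor bound each product arises from only
    H^o(1) of these words.

    Upper bound.  For a finite set of primes let f(M) be the number of those
    dividing det M.  For a uniform residue matrix each prime p divides det M with
    probability q_p, about 1/p, whereas it divides det (A_1 ... A_m) with
    probability 1 - (1 - q_p)^m, about m/p.  By Cauchy-Schwarz,
    #W^2 <= (sum_W 2^f(W)) (sum_W 2^-f(W)).  Bound the first sum by summing over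
    all matrices with entries at most (nH)^m, the second by summing over all
    m-tuples; as H tends to infinity both factor over the primes, and the result
    is O(H^(2mn^2)) times prod_p (1 + q_p)(1 + (1 - q_p)^m)/2, which is at most
    prod_p (1 - c/p) for some c > 0 as soon as m >= 3.  The latter product tends
    to 0 because the sum of the reciprocals of the primes diverges. *)

(** * The divisor bound, with an integer exponent [k] in place of an epsilon *)

Section DivisorBound.

Local Open Scope nat_scope.

Lemma leq_wexp2r e a b : a <= b -> a ^ e <= b ^ e.
Proof. by case: e => // e; rewrite leq_exp2r. Qed.

(** A divisor is the product of its p-part, [p ^ i] with [i <= e], and its prime-to-p part, which
    divides [M]. *)
Lemma size_divisors_pfactor p e M : prime p -> coprime p M -> 0 < M ->
  size (divisors (p ^ e * M)) <= e.+1 * size (divisors M).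
Proof.
move=> p_pr copM M_gt0.
have N_gt0 : 0 < p ^ e * M by rewrite muln_gt0 expn_gt0 prime_gt0.
rewrite -{1}(size_iota 0 e.+1) -(size_allpairs (fun i d => p ^ i * d)).
apply: uniq_leq_size (divisors_uniq _) _ => d.
rewrite -dvdn_divisors // => dvd_d.
have d_gt0 : 0 < d by apply: dvdn_gt0 dvd_d.
rewrite -(partnC p d_gt0) p_part.
apply: (allpairs_f (fun i d => p ^ i * d)).
  rewrite mem_iota /= add0n ltnS.
  have := dvdn_leq_log p N_gt0 dvd_d.
  rewrite lognM ?expn_gt0 ?(prime_gt0 p_pr) // pfactorK //.
  by rewrite (logn_coprime copM) addn0.
rewrite -dvdn_divisors //.
have cop : coprime d`_p^' (p ^ e).
  by rewrite coprimeXr // coprime_sym (pnat_coprime (pnat_id p_pr)) ?part_pnat.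
by rewrite -(Gauss_dvdr _ cop) (dvdn_trans (dvdn_part _ _)).
Qed.

Lemma size_divisors_prod (ps : seq nat) (e : nat -> nat) :
  uniq ps -> all prime ps ->
  size (divisors (\prod_(p <- ps) p ^ e p)) <= \prod_(p <- ps) (e p).+1.
Proof.
elim: ps => [|p ps IH] /=; first by rewrite !big_nil.
move=> /andP[pNps ups] /andP[p_pr aps]; rewrite !big_cons.
apply: leq_trans (size_divisors_pfactor _ _ _ _ _ _) _ => //; last first.
- by rewrite leq_mul2l IH ?orbT.
- rewrite big_seq; apply: prodn_cond_gt0 => q /(allP aps) q_pr.
  by rewrite expn_gt0 prime_gt0.
rewrite big_seq; elim/big_rec: _ => [|q x q_in IHx]; first exact: coprimen1.
rewrite coprimeMr IHx andbT coprimeXr // prime_coprime // dvdn_prime2 //.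
  by apply: contra pNps => /eqP ->.
exact: (allP aps).
Qed.

Lemma expnS_pow2_bound k e : 0 < k -> e.+1 ^ k <= k ^ k * 2 ^ e.
Proof.
move=> k_gt0.
(* With q the quotient of e by k, e + 1 <= k(q + 1) <= k 2^q, and qk <= e. *)
have h : e.+1 <= k * 2 ^ (e %/ k).
  apply: leq_trans (_ : k * (e %/ k).+1 <= _).
    by rewrite mulnC ltn_ceil.
  by rewrite leq_mul2l ltn_expl ?orbT.
apply: leq_trans (_ : (k * 2 ^ (e %/ k)) ^ k <= _); first by rewrite leq_exp2r.
rewrite expnMn -expnM leq_mul2l leq_exp2l // leq_trunc_div orbT //.
Qed.

(** For [p >= 2 ^ k] the factor (e + 1)^k is at most (2^e)^k <= p^e, so no constant is lost. Each of
    the fewer than [2 ^ k] smaller primes costs at most [k ^ k], whence the value of C. *)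
Lemma divisor_bound k : 0 < k ->
  exists2 C, 0 < C & forall N, 0 < N -> size (divisors N) ^ k <= C * N.
Proof.
move=> k_gt0; exists ((k ^ k) ^ (2 ^ k)); first by rewrite !expn_gt0 k_gt0.
move=> N N_gt0.
pose c p := if p < 2 ^ k then k ^ k else 1.
have NE : N = \prod_(p <- primes N) p ^ logn p N.
  by rewrite {1}(prod_prime_decomp N_gt0) prime_decompE big_map.
have ap : all prime (primes N).
  by apply/allP => p; rewrite mem_primes => /andP[].
rewrite {1}NE.
apply: leq_trans (_ : (\prod_(p <- primes N) (logn p N).+1) ^ k <= _).
  by rewrite leq_exp2r // size_divisors_prod ?primes_uniq.
apply: leq_trans (_ : \prod_(p <- primes N) (c p * p ^ logn p N) <= _).
  rewrite (big_morph _ (fun x y => expnMn x y k) (exp1n k)).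
  rewrite big_seq [leqRHS]big_seq; apply: leq_prod => p /(allP ap) p_pr.
  rewrite /c; case: ltnP => hp.
    apply: leq_trans (expnS_pow2_bound _ _ k_gt0) _.
    by rewrite leq_mul2l leq_wexp2r ?prime_gt1 ?orbT.
  rewrite mul1n; apply: leq_trans (_ : (2 ^ k) ^ logn p N <= _).
    rewrite -expnM mulnC expnM leq_exp2r //; exact: ltn_expl.
  exact: leq_wexp2r.
rewrite big_split /= -NE leq_mul2r; apply/orP; right.
rewrite /c -big_mkcond /= big_const_seq iter_muln_1.
rewrite leq_pexp2l ?expn_gt0 ?k_gt0 // -size_filter.
rewrite -[leqRHS](size_iota 0); apply: uniq_leq_size.
  by rewrite filter_uniq // primes_uniq.
by move=> p; rewrite mem_filter mem_iota /= => /andP[].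
Qed.

End DivisorBound.

(** * Products over primes of 1 - 1/(Dp) become arbitrarily small *)

Section EulerProduct.

Import Order.TTheory GRing.Theory Num.Theory.
Local Open Scope ring_scope.

Definition smooth (i k : nat) : bool := all (fun p => p < i)%N (primes k).

(** The cutoff at [y] keeps the sum finite; the Euler product formula then becomes an inequality. *)
Definition smooth_sum (y i : nat) : rat :=
  \sum_(k < y.+1 | (0 < k)%N && smooth i k) (k%:R)^-1.

Lemma smooth_sum_ge0 y i : 0 <= smooth_sum y i.
Proof. by apply: sumr_ge0 => k _; rewrite invr_ge0. Qed.

Lemma smoothM i j p : (0 < j)%N -> prime p -> (p < i)%N ->
  smooth i (p * j) = smooth i j.
Proof.
move=> j_gt0 p_pr lt_pi; apply/allP/allP => h q.
  rewrite mem_primes => /and3P[q_pr _ dq]; apply: h.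
  by rewrite mem_primes q_pr muln_gt0 j_gt0 prime_gt0 //= dvdn_mull.
rewrite primesM ?(prime_gt0 p_pr) // => /orP[|/h //].
by rewrite primes_prime // inE => /eqP ->.
Qed.

Lemma smoothS_notdvd i k : smooth i.+1 k -> ~~ (i %| k)%N -> smooth i k.
Proof.
move=> /allP h ndvd; apply/allP => p p_in; have := h p p_in.
rewrite ltnS leq_eqVlt => /orP[/eqP pi|//].
by move: p_in ndvd; rewrite mem_primes pi => /and3P[_ _ ->].
Qed.

(** Substitute k = pj: the cofactor j is again smooth, and allowing every j up to [y] only adds
    nonnegative terms. *)
Lemma smooth_sum_dvd y p : prime p ->
  \sum_(k < y.+1 | [&& (0 < k)%N, smooth p.+1 k & (p %| k)%N]) (k%:R)^-1
    <= (p%:R)^-1 * smooth_sum y p.+1.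
Proof.
move=> p_pr; have p_gt0 := prime_gt0 p_pr.
rewrite (reindex_onto (fun j : 'I_y.+1 => inord (p * j))
                      (fun k : 'I_y.+1 => inord (k %/ p))) /=; last first.
  move=> k /and3P[k_gt0 _ dk]; apply/val_inj.
  have hk : (k %/ p < y.+1)%N by apply: leq_ltn_trans (leq_div _ _) _.
  by rewrite /= (inordK hk) mulnC divnK ?inordK.
rewrite /smooth_sum mulr_sumr big_mkcond [leRHS]big_mkcond /=.
apply: ler_sum => j _; have [le_pj|lt_pj] := leqP (p * j) y; last first.
  (* Beyond [y], [inord] falls back to 0, an index that the condition [0 < k] excludes. *)
  have -> : (inord (p * j) : 'I_y.+1) = 0%N :> nat.
    by rewrite /inord val_insubd ltnNge lt_pj.
  by case: ifP => // _; rewrite mulr_ge0 ?invr_ge0.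
rewrite inordK //.
case: (posnP j) => [->|j_gt0]; first by rewrite muln0 /=.
rewrite smoothM // muln_gt0 p_gt0 j_gt0 /= natrM invfM.
case: ifP => [/andP[/andP[-> _] _] //|_].
by case: ifP => // _; rewrite mulr_ge0 ?invr_ge0.
Qed.

(** Multiples of p carry at most 1/p of the whole sum; the other terms have all their prime factors
    below p. *)
Lemma smooth_sumS y p : prime p ->
  smooth_sum y p.+1 * (1 - (p%:R)^-1) <= smooth_sum y p.
Proof.
move=> p_pr; rewrite mulrBr mulr1 lerBlDr [_ * _^-1]mulrC.
rewrite {1}/smooth_sum (bigID (fun k : 'I__ => (p %| k)%N)) /= addrC.
apply: lerD; last first.
  by under eq_bigl do rewrite -andbA; exact: smooth_sum_dvd.
rewrite big_mkcond [leRHS]big_mkcond; apply: ler_sum => k _.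
case: ifP => [/andP[/andP[-> sk] /(smoothS_notdvd _ _ sk) ->] //|_].
by case: ifP => // _; rewrite invr_ge0.
Qed.

Lemma smoothS_notprime i k : ~~ prime i -> smooth i.+1 k = smooth i k.
Proof.
move=> ni; apply: eq_in_all => p; rewrite mem_primes => /andP[p_pr _].
rewrite ltnS leq_eqVlt; case: eqP => // pi.
by move: ni; rewrite -pi p_pr.
Qed.

Lemma euler_prod_ge0 D i : (0 < D)%N ->
  0 <= \prod_(0 <= p < i | prime p) (1 - ((D * p)%:R)^-1 : rat).
Proof.
move=> D_gt0; apply: prodr_ge0 => p p_pr.
rewrite subr_ge0 invf_le1 ?ler1n ?ltr0n muln_gt0 D_gt0 prime_gt0 //.
Qed.

(** Euler factors are peeled off one prime at a time. At [i = 0] only the term k = 1 can remain,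
    since every k > 1 has a prime factor. *)
Lemma smooth_sum_prod y i :
  smooth_sum y i * \prod_(0 <= p < i | prime p) (1 - (p%:R)^-1) <= 1.
Proof.
elim: i => [|i IH].
  rewrite big_geq // mulr1 /smooth_sum; case: y => [|y].
    by rewrite big_mkcond big_ord_recl big_ord0.
  rewrite (bigD1 (inord 1)) /=; last by rewrite inordK.
  rewrite inordK // invr1 big1 ?addr0 // => k.
  case/andP => /andP[k_gt0 sk] /eqP kN1; case: kN1; apply: val_inj.
  rewrite /= inordK //; apply/eqP; rewrite eqn_leq k_gt0 andbT leqNgt.
  apply/negP => k_gt1; move/allP: sk => /(_ (pdiv k)).
  by rewrite mem_primes pdiv_prime // k_gt0 pdiv_dvd => /(_ isT).
rewrite big_mkcond big_nat_recr //= -big_mkcond; case: ifP => [pi|/negbT ni].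
  rewrite mulrCA mulrC; apply: le_trans IH.
  apply: ler_wpM2r; last exact: smooth_sumS.
  by have := euler_prod_ge0 1 i isT; under eq_bigr do rewrite mul1n.
rewrite mulr1; suff -> : smooth_sum y i.+1 = smooth_sum y i by [].
by apply: eq_bigl => k; rewrite smoothS_notprime.
Qed.

(** Each dyadic block of 2^j terms, all at least 1/2^(j+1), contributes at least 1/2. *)
Lemma harmonic_ge j :
  1 + j%:R / 2 <= \sum_(k < (2 ^ j).+1 | (0 < k)%N) (k%:R)^-1 :> rat.
Proof.
rewrite -(big_mkord (fun k => 0 < k)%N (fun k => (k%:R)^-1 : rat)).
elim: j => [|j IH].
  by rewrite big_mkcond expn0 !big_nat_recr //= big_geq.
rewrite (big_cat_nat (n := (2 ^ j).+1)) //=; last by rewrite ltnS leq_exp2l.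
apply: le_trans (_ : (1 + j%:R / 2) + 1 / 2 <= _).
  by rewrite -natr1; lra.
apply: lerD => //.
apply: le_trans (_ : \sum_((2 ^ j).+1 <= k < (2 ^ j.+1).+1 | (0 < k)%N)
   ((2 ^ j.+1)%:R)^-1 <= _).
  rewrite big_mkcond big_nat (eq_bigr (fun=> ((2 ^ j.+1)%:R)^-1)); last first.
    by move=> k /andP[hk _]; case: posnP hk => // ->.
  rewrite -big_nat sumr_const_nat subSS expnS mul2n -addnn addnK -[leRHS]mulr_natl.
  rewrite natrD; have : 0 < (2 ^ j)%:R :> rat by rewrite ltr0n expn_gt0.
  move: ((2 ^ j)%:R : rat) => t t_gt0.
  by rewrite le_eqVlt; apply/orP; left; apply/eqP; field; lra.
rewrite [leLHS]big_nat_cond [leRHS]big_nat_cond.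
apply: ler_sum => k /andP[/andP[_ hk] k_gt0].
by rewrite lef_pV2 ?posrE ?ltr0n ?expn_gt0 // ler_nat.
Qed.

Lemma bernoulli_ge (x : rat) k : 0 <= x -> 1 + k%:R * x <= (1 + x) ^+ k.
Proof.
move=> x_ge0; elim: k => [|k IH]; first by rewrite expr0 mul0r addr0.
rewrite exprS; have : (1 + x) * (1 + k%:R * x) <= (1 + x) * (1 + x) ^+ k.
  by rewrite ler_wpM2l // addr_ge0.
apply: le_trans; rewrite -natr1; have : 0 <= k%:R * x * x by rewrite !mulr_ge0.
by nra.
Qed.

(* With [x = 1/(Dp)]: [(1 - x)^(2D) <= 1/(1 + x)^(2D) <= 1/(1 + 2/p)]. *)
Lemma euler_factor_le D p : (0 < D)%N -> prime p ->
  (1 - ((D * p)%:R)^-1 : rat) ^+ D.*2 <= 1 - (p%:R)^-1.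
Proof.
move=> D_gt0 p_pr; set x := ((D * p)%:R)^-1.
have p_ge2 : 2 <= p%:R :> rat by rewrite ler_nat prime_gt1.
have x_ge0 : 0 <= x by rewrite invr_ge0.
have D_neq0 : D%:R != 0 :> rat by rewrite pnatr_eq0 -lt0n.
have x_le1 : x <= 1.
  by rewrite invf_le1 ?ler1n ?ltr0n muln_gt0 D_gt0 prime_gt0.
set z := (p%:R)^-1 : rat.
have z_ge0 : 0 <= z by rewrite invr_ge0.
have z_le : z <= 2^-1 by rewrite lef_pV2 ?posrE //; lra.
have DxE : D.*2%:R * x = 2 * z.
  by rewrite /x /z -mul2n !natrM; field; rewrite D_neq0 andbT; lra.
have h1 : (1 - x) ^+ D.*2 * (1 + x) ^+ D.*2 <= 1.
  by rewrite -exprMn exprn_ile1 //; nra.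
have h2 := bernoulli_ge x D.*2 x_ge0; rewrite DxE in h2.
have h3 : 0 <= (1 - x) ^+ D.*2 by rewrite exprn_ge0 // subr_ge0.
have h4 : (1 - x) ^+ D.*2 * (1 + 2 * z) <= 1.
  by apply: le_trans h1; rewrite ler_wpM2l.
have h5 : 1 <= (1 - z) * (1 + 2 * z) by nra.
have z2_gt0 : 0 < 1 + 2 * z by lra.
by rewrite -(ler_pM2r z2_gt0) (le_trans h4).
Qed.

Lemma euler_prod_small D K : (0 < D)%N ->
  exists ps : seq nat, [/\ uniq ps, all prime ps &
    K%:R * \prod_(p <- ps) (1 - ((D * p)%:R)^-1) <= 1 :> rat].
Proof.
(* This [y] makes the harmonic sum up to [y] at least K^(2D). *)
move=> D_gt0; pose y := (2 ^ (2 * K ^ D.*2))%N.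
exists [seq p <- iota 0 y.+1 | prime p]; split.
- by rewrite filter_uniq ?iota_uniq.
- exact: filter_all.
rewrite big_filter -[iota 0 y.+1]/(index_iota 0 y.+1).
set E := \prod_(_ <- _ | _) _.
have E_ge0 : 0 <= E := euler_prod_ge0 D y.+1 D_gt0.
have := smooth_sum_prod y y.+1; set E1 := \prod_(_ <= _ < _ | _) _ => hs.
have E1_ge : E ^+ D.*2 <= E1.
  rewrite -prodrXl; apply: ler_prod => p p_pr; rewrite euler_factor_le // andbT.
  rewrite exprn_ge0 // subr_ge0.
  by rewrite invf_le1 ?ler1n ?ltr0n muln_gt0 D_gt0 prime_gt0.
have s_ge : (K ^ D.*2)%:R <= smooth_sum y y.+1.
  have := harmonic_ge (2 * K ^ D.*2).
  rewrite natrM mulrC mulKf // => hh; apply: le_trans (_ : 1 + (K ^ D.*2)%:R <= _).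
    by rewrite lerDr.
  apply: le_trans hh _; rewrite /smooth_sum le_eqVlt; apply/orP; left; apply/eqP.
  apply: eq_bigl => k; case: posnP => //= k_gt0; symmetry; apply/allP => p.
  rewrite mem_primes => /and3P[_ _ /(dvdn_leq k_gt0) pk].
  exact: leq_ltn_trans pk _.
(* Compare 2D-th powers: E^(2D) is at most the Euler product [E1], and K^(2D) [E1] <= 1 by [s_ge]
   and [hs]. *)
rewrite -(@expr_le1 _ D.*2) ?double_gt0 ?mulr_ge0 // exprMn -natrX.
apply: le_trans hs; apply: ler_pM => //; exact: exprn_ge0.
Qed.
End EulerProduct.

(** * Periodic functions summed over boxes, and their factorization over primes *)

Section PeriodicSums.

Import Order.TTheory GRing.Theory Num.Theory.
Local Open Scope nat_scope.

Lemma leq_sum_inj (T U : finType) (phi : T -> U) (F : T -> nat) (G : U -> nat) :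
  injective phi -> (forall t, F t <= G (phi t)) -> \sum_t F t <= \sum_u G u.
Proof.
move=> phi_inj FG; apply: leq_trans (_ : \sum_t G (phi t) <= _).
  by apply: leq_sum => t _.
rewrite -(big_imset (h := phi) G (A := predT)) /=; last by move=> *; apply: phi_inj.
rewrite big_mkcond; apply: leq_sum => u _; by case: ifP.
Qed.

Variable I : finType.

Definition periodic (F : (I -> int) -> nat) (q : nat) : Prop :=
  forall x y : I -> int, (forall i, (q %| (x i - y i)%R)%Z) -> F x = F y.

Definition res_sum (F : (I -> int) -> nat) (q : nat) : nat :=
  \sum_(x : {ffun I -> 'I_q}) F (fun i => Posz (x i)).

Lemma dvdz_sub_modn (q k : nat) : (q %| (Posz k - Posz (k %% q)%N)%R)%Z.
Proof. by rewrite -eqz_mod_dvd -modz_nat modz_mod. Qed.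

(* By the Chinese remainder theorem this is an equality; the injection giving
   the inequality is all that is needed. *)
Lemma res_sum_mul F G a b : coprime a b -> 0 < a -> 0 < b ->
  periodic F a -> periodic G b ->
  res_sum (fun x => F x * G x) (a * b) <= res_sum F a * res_sum G b.
Proof.
move=> cop a_gt0 b_gt0 perF perG.
rewrite /res_sum big_distrlr /= pair_bigA /=.
pose phi (x : {ffun I -> 'I_(a * b)}) :=
  ([ffun i => Ordinal (ltn_pmod (x i) a_gt0)] : {ffun I -> 'I_a},
   [ffun i => Ordinal (ltn_pmod (x i) b_gt0)] : {ffun I -> 'I_b}).
apply: (@leq_sum_inj _ _ phi) => [x y [/ffunP eqa /ffunP eqb]|x] /=.
  apply/ffunP => i; apply/val_inj => /=.
  have /(congr1 val) := eqa i; have /(congr1 val) := eqb i; rewrite !ffunE /=.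
  move=> hb ha; have := chinese_remainder cop (x i) (y i).
  by rewrite ha hb !eqxx /= !modn_small // => /eqP.
rewrite (perF _ (fun i => Posz ((phi x).1 i))); last first.
  move=> i; rewrite /= ffunE; exact: dvdz_sub_modn.
rewrite (perG _ (fun i => Posz ((phi x).2 i))) // => i.
rewrite /= ffunE; exact: dvdz_sub_modn.
Qed.

Lemma prod_primes_gt0 (ps : seq nat) : all prime ps -> 0 < \prod_(p <- ps) p.
Proof.
by move=> aps; rewrite big_seq; apply: prodn_cond_gt0 => q /(allP aps) /prime_gt0.
Qed.

Lemma periodic_prod (ps : seq nat) (F : nat -> (I -> int) -> nat) :
  all prime ps -> (forall p, prime p -> periodic (F p) p) ->
  periodic (fun x => \prod_(p <- ps) F p x) (\prod_(p <- ps) p).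
Proof.
move=> aps perF x y xy; rewrite big_seq [RHS]big_seq.
apply: eq_bigr => q q_in; apply: perF => [|i]; first exact: (allP aps).
have dvd_q : q %| \prod_(j <- ps) j by rewrite (big_rem q) //= dvdn_mulr.
by apply: dvdz_trans (xy i); rewrite dvdzE.
Qed.

Lemma res_sum_prod (ps : seq nat) (F : nat -> (I -> int) -> nat) :
  uniq ps -> all prime ps -> (forall p, prime p -> periodic (F p) p) ->
  res_sum (fun x => \prod_(p <- ps) F p x) (\prod_(p <- ps) p)
    <= \prod_(p <- ps) res_sum (F p) p.
Proof.
move=> + + perF; elim: ps => [|p ps IH] /=.
  move=> _ _; rewrite /res_sum !big_nil.
  under eq_bigr do rewrite big_nil.
  by rewrite sum1_card card_ffun card_ord exp1n.
move=> /andP[pNps ups] /andP[p_pr aps]; rewrite !big_cons.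
have cop : coprime p (\prod_(j <- ps) j).
  rewrite big_seq; elim/big_rec: _ => [|q x q_in IHx]; first exact: coprimen1.
  rewrite coprimeMr IHx andbT prime_coprime // dvdn_prime2 ?(allP aps _ q_in) //.
  by apply: contra pNps => /eqP ->.
apply: leq_trans (_ : res_sum (F p) p *
  res_sum (fun x => \prod_(j <- ps) F j x) (\prod_(j <- ps) j) <= _); last first.
  by rewrite leq_mul2l IH ?orbT.
have -> N : res_sum (fun x => \prod_(j <- p :: ps) F j x) N =
    res_sum (fun x => F p x * \prod_(j <- ps) F j x) N.
  by apply: eq_bigr => x _; rewrite big_cons.
apply: res_sum_mul => //; first exact: prime_gt0.
- exact: prod_primes_gt0.
- exact: perF.
- exact: periodic_prod.
Qed.

(** After a shift by [B] the coordinates lie in [0, 2B]. A point is determined by the quotients and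
    residues of its coordinates modulo q, so each residue vector occurs at most once per vector of
    quotients. *)
Lemma sum_periodic_le (T : finType) (iota : T -> I -> int) F q B :
  0 < q -> periodic F q ->
  (forall t t', iota t =1 iota t' -> t = t') ->
  (forall t i, `|iota t i|%N <= B) ->
  \sum_t F (iota t) <= (B.*2 %/ q).+1 ^ #|I| * res_sum F q.
Proof.
move=> q_gt0 perF iota_inj iotaB.
have modq (x : int) : `|(x %% q)%Z|%N < q.
  have qN0 : Posz q != 0%R by rewrite -lt0n.
  by rewrite -ltz_nat gez0_abs ?modz_ge0 // ltz_mod.
pose u t i := `|(iota t i + Posz B)%R|%N.
have uE t i : Posz (u t i) = (iota t i + Posz B)%R.
  by have := iotaB t i; rewrite /u; lia.
have uB t i : u t i %/ q <= B.*2 %/ q.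
  by apply: leq_div2r; have := iotaB t i; rewrite /u; lia.
pose phi (t : T) :=
  ([ffun i => inord (u t i %/ q)] : {ffun I -> 'I_(B.*2 %/ q).+1},
   [ffun i => Ordinal (modq (iota t i))] : {ffun I -> 'I_q}).
apply: leq_trans (leq_sum_inj _ _ phi _
  (fun w => F (fun i => Posz (w.2 i))) _ _) _.
- move=> t t' [/ffunP eqd /ffunP eqm]; apply: iota_inj => i.
  have /(congr1 val) := eqd i; rewrite !ffunE /= !inordK ?ltnS // => hd.
  have /(congr1 (fun k : 'I_q => Posz k)) := eqm i; rewrite !ffunE /=.
  have qN0 : Posz q != 0%R by rewrite -lt0n.
  rewrite !gez0_abs ?modz_ge0 // => /eqP; rewrite eqz_mod_dvd => hm.
  have {}hm : u t i = u t' i %[mod q].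
    have : (q %| (Posz (u t i) - Posz (u t' i))%R)%Z.
      by rewrite !uE opprD addrACA subrr addr0.
    by rewrite -eqz_mod_dvd !modz_nat eqz_nat => /eqP.
  have /eqP : u t i = u t' i by rewrite (divn_eq (u t i) q) hd hm -divn_eq.
  by rewrite -eqz_nat !uE (inj_eq (addIr _)) => /eqP.
- move=> t; rewrite (perF _ (fun i => Posz ((phi t).2 i))) // => i.
  have qN0 : Posz q != 0%R by rewrite -lt0n.
  by rewrite ffunE /= gez0_abs ?modz_ge0 // -eqz_mod_dvd modz_mod.
rewrite -(pair_bigA _ (fun _ (w : {ffun I -> 'I_q}) =>
  F (fun i => Posz (w i)))) /=.
by rewrite sum_nat_const card_ffun card_ord.
Qed.

End PeriodicSums.

Arguments periodic {I}.
Arguments res_sum {I}.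

(** * Weighted counts of matrices and tuples modulo one prime *)

Section LocalCounts.

Import Order.TTheory GRing.Theory Num.Theory.
Local Open Scope ring_scope.

Definition mx_of_fun n (x : 'I_n * 'I_n -> int) : 'M[int]_n :=
  \matrix_(i, j) x (i, j).

(* The factors of 2^f at p, and of 2^-f rescaled by 2 to stay in nat. *)
Definition det_weight n p (x : 'I_n * 'I_n -> int) : nat :=
  if (p %| \det (mx_of_fun n x))%Z then 2 else 1.

Definition tuple_weight m n p (x : 'I_m * ('I_n * 'I_n) -> int) : nat :=
  if (p %| \prod_(l < m) \det (mx_of_fun n (fun ij => x (l, ij))))%Z
  then 1 else 2.

Definition GLcount n p : nat := #|[set M : 'M['F_p]_n | M \in unitmx]|.

Lemma GLcountE n p : (0 < n)%N -> prime p ->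
  GLcount n p = (p ^ 'C(n, 2) * \prod_(1 <= i < n.+1) (p ^ i - 1))%N.
Proof.
case: n => // n _ p_pr; have := card_GL 'F_p (ltn0Sn n); rewrite card_Fp //.
move=> <-; rewrite /GLcount cardsT /= card_sub; apply: eq_card => M.
by rewrite !inE.
Qed.

(** Puts [p ^ (n ^ 2)] in the shape of the order of GL_n, so that the two can be compared factor by
    factor. *)
Lemma expn_sqrE n p :
  (p ^ (n ^ 2) = p ^ 'C(n, 2) * \prod_(1 <= i < n.+1) p ^ i)%N.
Proof.
rewrite -expn_sum -expnD; congr (_ ^ _)%N.
have -> : (\sum_(1 <= i < n.+1) i = 'C(n.+1, 2))%N.
  by rewrite -bin2_sum [RHS]big_ltn.
by elim: n => // n IH; rewrite binS bin1 [in RHS]binS bin1 -addnACA -{}IH; nia.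
Qed.

(** The factor i = 1 alone yields the density bound 1 - 1/p; the other factors are at most 1. *)
Lemma GLcount_upper n p : (0 < n)%N -> prime p ->
  (p * GLcount n p <= p.-1 * p ^ (n ^ 2))%N.
Proof.
move=> n_gt0 p_pr; rewrite GLcountE // expn_sqrE mulnCA [leqRHS]mulnCA leq_mul2l.
apply/orP; right; rewrite big_ltn // [X in (_ <= _ * X)%N]big_ltn // !expn1 subn1.
rewrite mulnCA leq_mul2l leq_mul2l; apply/orP; right; apply/orP; right.
by apply: leq_prod => i _; rewrite leq_subr.
Qed.

(** Each of the n factors 1 - p^-i is at least 1/2, which gives a density bound uniform in p. *)
Lemma GLcount_lower n p : (0 < n)%N -> prime p ->
  (p ^ (n ^ 2) <= 2 ^ n * GLcount n p)%N.
Proof.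
move=> n_gt0 p_pr; rewrite GLcountE // expn_sqrE mulnCA leq_mul2l.
apply/orP; right.
have -> : (2 ^ n = \prod_(1 <= i < n.+1) 2)%N by rewrite prod_nat_const_nat subSS subn0.
rewrite -big_split /= big_nat [leqRHS]big_nat; apply: leq_prod => i /andP[i_gt0 _].
have : (2 <= p ^ i)%N.
  apply: leq_trans (prime_gt1 p_pr) _; rewrite -{1}[p]expn1 leq_pexp2l //.
  exact: prime_gt0.
lia.
Qed.

Definition mx_mod n p (x : 'I_n * 'I_n -> int) : 'M['F_p]_n :=
  \matrix_(i, j) (x (i, j))%:~R.

Lemma mx_mod_unit n p x : prime p ->
  (mx_mod n p x \in unitmx) = ~~ (p %| \det (mx_of_fun n x))%Z.
Proof.
move=> p_pr; rewrite (dvdz_pcharf (pchar_Fp p_pr)) unitmxE unitfE.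
congr (~~ (_ == _)); rewrite -(det_map_mx (intmul 1)); congr (\det _).
by apply/matrixP => i j; rewrite !mxE.
Qed.

Lemma det_weightE n p x : prime p ->
  det_weight n p x = if mx_mod n p x \in unitmx then 1%N else 2%N.
Proof. by move=> p_pr; rewrite mx_mod_unit // /det_weight if_neg. Qed.

Lemma tuple_weightE m n p x : prime p ->
  tuple_weight m n p x =
  if [forall l, mx_mod n p (fun ij => x (l, ij)) \in unitmx] then 2%N else 1%N.
Proof.
move=> p_pr; rewrite /tuple_weight (dvdz_pcharf (pchar_Fp p_pr)) rmorph_prod.
rewrite -if_neg; congr (if _ then _ else _).
apply/prodf_neq0/forallP => /= h l; last move=> _;
  have := h l; rewrite mx_mod_unit // (dvdz_pcharf (pchar_Fp p_pr)) //.
exact.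
Qed.

Lemma eq_mx_mod n p x y : prime p ->
  (forall ij, (p %| x ij - y ij)%Z) -> mx_mod n p x = mx_mod n p y.
Proof.
move=> p_pr h; apply/matrixP => i j; rewrite !mxE; apply/eqP.
by rewrite -subr_eq0 -intrB -(dvdz_pcharf (pchar_Fp p_pr)).
Qed.

Lemma periodic_det_weight n p : prime p -> periodic (det_weight n p) p.
Proof. by move=> p_pr x y h; rewrite !det_weightE // (eq_mx_mod _ _ _ _ p_pr h). Qed.

Lemma periodic_tuple_weight m n p : prime p -> periodic (tuple_weight m n p) p.
Proof.
move=> p_pr x y h.
have E l : (mx_mod n p (fun ij => x (l, ij)) \in unitmx) =
           (mx_mod n p (fun ij => y (l, ij)) \in unitmx).
  by rewrite (eq_mx_mod _ _ _ (fun ij => y (l, ij)) p_pr) // => ij; apply: h.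
by rewrite (tuple_weightE _ _ _ _ p_pr) (eq_forallb E) -tuple_weightE.
Qed.

Lemma mx_mod_inj n p (x y : 'I_n * 'I_n -> 'I_p) : prime p ->
  mx_mod n p (fun ij => Posz (x ij)) = mx_mod n p (fun ij => Posz (y ij)) -> x =1 y.
Proof.
move=> p_pr /matrixP h [i j]; have := h i j; rewrite !mxE => /eqP.
rewrite -subr_eq0 -intrB -(dvdz_pcharf (pchar_Fp p_pr)) -eqz_mod_dvd !modz_nat.
by rewrite !modn_small // => /eqP [] /val_inj.
Qed.

(** Singular residues weigh 2 and invertible ones 1, so adding [GLcount] brings every weight up to
    2. *)
Lemma res_sum_det n p : prime p ->
  (res_sum (det_weight n p) p + GLcount n p <= 2 * p ^ (n ^ 2))%N.
Proof.
move=> p_pr.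
pose w (M : 'M['F_p]_n) : nat := if M \in unitmx then 1%N else 2%N.
apply: leq_trans (_ : \sum_M w M + GLcount n p <= _)%N.
  rewrite leq_add2r; apply: (leq_sum_inj _ _
    (fun x : {ffun 'I_n * 'I_n -> 'I_p} => mx_mod n p (fun ij => Posz (x ij)))).
    by move=> x y /(mx_mod_inj _ _ _ _ p_pr) /ffunP.
  by move=> x; rewrite det_weightE.
rewrite /GLcount -sum1dep_card [X in (_ + X <= _)%N]big_mkcond -big_split /=.
rewrite (eq_bigr (fun=> 2%N)) => [|M _]; last by rewrite /w; case: ifP.
by rewrite sum_nat_const card_mx card_Fp // mulnC mulnn.
Qed.

(** The weight is 1 plus the indicator that all m residues are invertible. *)
Lemma res_sum_tuple m n p : prime p ->
  (res_sum (tuple_weight m n p) p <= (p ^ (n ^ 2)) ^ m + GLcount n p ^ m)%N.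
Proof.
move=> p_pr.
pose w (M : {ffun 'I_m -> 'M['F_p]_n}) : nat :=
  if [forall l, M l \in unitmx] then 2%N else 1%N.
apply: leq_trans (_ : \sum_M w M <= _)%N.
  apply: (leq_sum_inj _ _ (fun x : {ffun 'I_m * ('I_n * 'I_n) -> 'I_p} =>
    [ffun l => mx_mod n p (fun ij => Posz (x (l, ij)))])).
    move=> x y /ffunP h; apply/ffunP => -[l ij]; have := h l; rewrite !ffunE.
    by move=> /(mx_mod_inj _ _ (fun ij => x (l, ij)) (fun ij => y (l, ij)) p_pr).
  move=> x; rewrite tuple_weightE // /w.
  by under [in X in (_ <= X)%N]eq_forallb do rewrite ffunE.
rewrite (eq_bigr (fun M : {ffun 'I_m -> 'M['F_p]_n} =>
  (1 + (M \in ffun_on [set M : 'M['F_p]_n | M \in unitmx]))%N)); last first.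
  move=> M _; rewrite /w; case: forallP => [h|h].
    suff -> : M \in ffun_on [set M : 'M['F_p]_n | M \in unitmx] by [].
    by apply/ffun_onP => l; rewrite inE.
  suff /negPf -> : M \notin ffun_on [set M : 'M['F_p]_n | M \in unitmx] by [].
  by apply/negP => /ffun_onP h'; apply: h => l; have := h' l; rewrite inE.
rewrite big_split /= sum1_card card_ffun card_mx card_Fp // mulnn card_ord.
rewrite leq_add2l -big_mkcond /= sum1_card card_ffun_on card_ord.
exact: leqnn.
Qed.

(** Here s is the density of invertible matrices, and the left side is the product of the two mean
    weights. Its slope at s = 1 is m - 2, so for m >= 3 it drops below 2 there. Quantitatively, with
    u = s(1 - s), the case m = 3 equals 2 - u - u^2. *)
Lemma local_factor_rat (s a b : rat) m : (3 <= m)%N ->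
  0 <= a -> a <= s -> s <= 1 - b -> 0 <= b -> 
  (2 - s) * (1 + s ^+ m) <= 2 - a * b.
Proof.
move=> m_ge3 a_ge0 a_le s_le b_ge0.
have s_ge0 : 0 <= s by lra.
have s_le1 : s <= 1 by lra.
have sm : s ^+ m <= s ^+ 3 by rewrite ler_wiXn2l.
apply: le_trans (_ : (2 - s) * (1 + s ^+ 3) <= _); first by rewrite ler_wpM2l; lra.
have h1 : 0 <= s * (1 - s) by nra.
have h2 : a * b <= s * (1 - s) by rewrite ler_pM //; lra.
have h3 : 0 <= (s * (1 - s)) * (s * (1 - s)) by rewrite mulr_ge0.
have -> : (2 - s) * (1 + s ^+ 3) = 2 - s * (1 - s) - (s * (1 - s)) * (s * (1 - s)) by ring.
lra.
Qed.

Lemma local_factor m n p : (3 <= m)%N -> (0 < n)%N -> prime p ->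
  (res_sum (det_weight n p) p * res_sum (tuple_weight m n p) p)%:R
   <= 2 * ((p ^ (n ^ 2)) ^ m.+1)%:R * (1 - ((2 ^ n.+1 * p)%:R)^-1) :> rat.
Proof.
move=> m_ge3 n_gt0 p_pr.
have := res_sum_det n p p_pr; have := res_sum_tuple m n p p_pr.
have := GLcount_upper n p n_gt0 p_pr; have := GLcount_lower n p n_gt0 p_pr.
set Q := (p ^ (n ^ 2))%N; set G := GLcount n p.
set S1 := res_sum (det_weight n p) p.
set S2 := res_sum (tuple_weight m n p) p => hl hu h2 h1.
have Q_gt0 : (0 < Q)%N by rewrite expn_gt0 prime_gt0.
have Qr : 0 < Q%:R :> rat by rewrite ltr0n.
have p_gt0 := prime_gt0 p_pr.
have pr : 0 < p%:R :> rat by rewrite ltr0n.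
have tr : 0 < (2 ^ n)%:R :> rat by rewrite ltr0n expn_gt0.
pose s : rat := G%:R / Q%:R.
have sE : G%:R = s * Q%:R by rewrite mulfVK // gt_eqF.
have s_ge : ((2 ^ n)%:R)^-1 <= s.
  rewrite ler_pdivlMr // mulrC ler_pdivrMr // -natrM ler_nat mulnC //.
have s_le : s <= 1 - (p%:R)^-1.
  rewrite ler_pdivrMr // -(ler_pM2l pr) mulrA mulrBr mulr1 divff ?gt_eqF //.
  rewrite -(natrB _ (prime_gt0 p_pr)) subn1 -!natrM ler_nat //.
have h1r : S1%:R <= (2 - s) * Q%:R.
  by rewrite mulrBl -sE lerBrDr -natrD -natrM ler_nat.
have h2r : S2%:R <= (1 + s ^+ m) * Q%:R ^+ m.
  by rewrite mulrDl mul1r -exprMn -sE -!natrX -natrD ler_nat.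
rewrite natrM; apply: le_trans (ler_pM _ _ h1r h2r) _ => //.
rewrite mulrACA -exprS natrX mulrC [leRHS]mulrAC.
rewrite [leLHS]mulrC ler_wpM2r ?exprn_ge0 //.
(* With a = 2^-n and b = 1/p the bound 2 - ab is 2(1 - 1/(2^(n+1) p)). *)
apply: le_trans (local_factor_rat s _ _ m m_ge3 _ s_ge s_le _) _; rewrite ?invr_ge0 //.
rewrite mulrBr mulr1 lerD2l lerN2 expnS !natrM !invfM.
have -> (x y : rat) : 2 * (2^-1 * x * y) = x * y by field.
by [].
Qed.

End LocalCounts.

(** * Determinants, entry bounds and coding of words *)

Section Words.

Import Order.TTheory GRing.Theory Num.Theory.
Local Open Scope ring_scope.

Lemma prod_wordS n m (A : 'I_m.+1 -> 'M[int]_n) :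
  prod_word A = A ord0 *m prod_word (fun i => A (lift ord0 i)).
Proof. by rewrite /prod_word enum_ordSl /= -map_comp. Qed.

Lemma prod_word0 n (A : 'I_0 -> 'M[int]_n) : prod_word A = 1%:M.
Proof. by rewrite /prod_word enum_ord0. Qed.

Lemma det_prod_word n m (A : 'I_m -> 'M[int]_n) :
  \det (prod_word A) = \prod_(l < m) \det (A l).
Proof.
elim: m A => [|m IH] A; first by rewrite prod_word0 det1 big_ord0.
by rewrite prod_wordS det_mulmx IH big_ord_recl.
Qed.

Lemma prod_word_bound n m H (A : 'I_m -> 'M[int]_n) :
  (forall l i j, (`|A l i j| <= H)%N) ->
  forall i j, (`|prod_word A i j| <= (n * H) ^ m)%N.
Proof.
elim: m A => [|m IH] A AH i j.
  by rewrite prod_word0 mxE; case: eqP.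
rewrite prod_wordS mxE -lez_nat abszE; apply: le_trans (ler_norm_sum _ _ _) _.
apply: le_trans (_ : \sum_(k < n) Posz (H * (n * H) ^ m) <= _).
  apply: ler_sum => k _; rewrite normrM -!abszE -PoszM lez_nat.
  by apply: leq_mul; [exact: AH | exact: IH].
by rewrite sumr_const card_ord -mulr_natl natz -PoszM lez_nat expnS mulnA.
Qed.

Lemma entry_of_bound H (k : 'I_(H.*2.+1)) : (`|entry_of k| <= H)%N.
Proof. by have := ltn_ord k; rewrite /entry_of; lia. Qed.

Lemma entry_of_inj H : injective (@entry_of H).
Proof. by move=> k k' /addIr [] /val_inj. Qed.

(** The boolean equality allows [xchoose] to select a factorization. *)
Lemma mem_words m n H (M : 'M[int]_n) : M \in words m n H ->
  exists f : {ffun 'I_m -> 'M['I_(H.*2.+1)]_n},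
    prod_word (fun i => mat_of (f i)) == M.
Proof. by case/mapP => f _ ->; exists f. Qed.

End Words.

(** * Cauchy-Schwarz and the upper bound *)

Section UpperBound.

Import Order.TTheory GRing.Theory Num.Theory.
Local Open Scope ring_scope.

(** By AM-GM, g(s)h(t) + g(t)h(s) >= 2c for every pair, because the product of the two terms is c^2;
    then sum over all pairs. *)
Lemma card_cauchy_schwarz (T : finType) (g h : T -> nat) c :
  (forall t, g t * h t = c)%N ->
  (#|T| ^ 2 * c <= (\sum_t g t) * (\sum_t h t))%N.
Proof.
move=> ghc.
have two_c s t : (2 * c <= g s * h t + g t * h s)%N.
  have := nat_AGM2 (g s * h t) (g t * h s); rewrite -leq_sqr => -[+ _].
  have -> : (g s * h t * (g t * h s) = c * c)%N.
    by rewrite mulnACA [(h t * _)%N]mulnC mulnACA !ghc.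
  by rewrite expnMn -[(c ^ 2)%N]mulnn.
rewrite -(leq_pmul2l (isT : 0 < 2)%N) [leqRHS]mul2n -addnn {2}[(_ * \sum_t h t)%N]mulnC.
rewrite !big_distrlr /= -big_split /=.
apply: leq_trans (_ : \sum_(s : T) \sum_(t : T) 2 * c <= _)%N.
  by rewrite !sum_nat_const mulnCA -mulnn -mulnA.
apply: leq_sum => s _; rewrite -big_split; apply: leq_sum => t _ /=.
by rewrite [(h s * _)%N]mulnC two_c.
Qed.

Lemma cardW_sqr_bound m n H ps : uniq ps -> all prime ps ->
  (cardW m n H ^ 2 * 2 ^ size ps <=
   (((n * H) ^ m).*2 %/ \prod_(p <- ps) p).+1 ^ (n ^ 2)
     * (\prod_(p <- ps) res_sum (det_weight n p) p)
   * (((H.*2 %/ \prod_(p <- ps) p).+1 ^ (m * n ^ 2))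
     * \prod_(p <- ps) res_sum (tuple_weight m n p) p))%N.
Proof.
move=> ups aps; set S := undup (words m n H).
have S_uniq : uniq S by exact: undup_uniq.
rewrite /cardW -/S -(card_seq_sub S_uniq).
have repP (t : seq_sub S) : exists f : {ffun 'I_m -> 'M['I_(H.*2.+1)]_n},
    prod_word (fun i => mat_of (f i)) == val t.
  by apply: mem_words; have := valP t; rewrite /S mem_undup.
(* One factorization is fixed per product: the first sum is indexed by the entries of the product,
   the second by those of its chosen tuple. *)
pose rep t := xchoose (repP t).
have repE t : prod_word (fun i => mat_of (rep t i)) = val t.
  exact/eqP/(xchooseP (repP t)).
pose x1 (t : seq_sub S) (ij : 'I_n * 'I_n) : int := val t ij.1 ij.2.
pose x2 (t : seq_sub S) (lij : 'I_m * ('I_n * 'I_n)) : int :=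
  mat_of (rep t lij.1) lij.2.1 lij.2.2.
have mx1 t : mx_of_fun n (x1 t) = val t by apply/matrixP => i j; rewrite mxE.
have mx2 t l : mx_of_fun n (fun ij => x2 t (l, ij)) = mat_of (rep t l).
  by apply/matrixP => i j; rewrite mxE.
have P_gt0 := prod_primes_gt0 _ aps.
apply: leq_trans (card_cauchy_schwarz _
  (fun t => \prod_(p <- ps) det_weight n p (x1 t))%N
  (fun t => \prod_(p <- ps) tuple_weight m n p (x2 t))%N _ _) _.
  (* By multiplicativity of the determinant the same divisibility decides both weights at p, so they
     multiply to 2. *)
  move=> t; rewrite -big_split /= (eq_bigr (fun=> 2%N)); last first.
    move=> p _; rewrite /det_weight /tuple_weight mx1 -repE det_prod_word.
    by under [in X in (_ * X)%N]eq_bigr do rewrite mx2; case: ifP.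
  by rewrite big_const_seq count_predT iter_muln_1.
apply: leq_mul.
  apply: leq_trans (sum_periodic_le _ _ x1 _ _ ((n * H) ^ m)%N P_gt0
    (periodic_prod _ _ _ aps (periodic_det_weight n)) _ _) _.
  - move=> t t' h; apply/val_inj/matrixP => i j; exact: h (i, j).
  - move=> t [i j]; rewrite /x1 -repE; apply: prod_word_bound => l i' j'.
    by rewrite mxE entry_of_bound.
  rewrite card_prod !card_ord mulnn leq_mul2l res_sum_prod ?orbT //.
  exact: periodic_det_weight.
apply: leq_trans (sum_periodic_le _ _ x2 _ _ H P_gt0
    (periodic_prod _ _ _ aps (periodic_tuple_weight m n)) _ _) _.
- move=> t t' h; apply/val_inj; rewrite -!repE.
  suff -> : rep t = rep t' by [].
  apply/ffunP => l; apply/matrixP => i j; have := h (l, (i, j)).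
  by rewrite /x2 /= !mxE => /entry_of_inj.
- by move=> t lij; rewrite /x2 mxE entry_of_bound.
rewrite !card_prod !card_ord mulnn leq_mul2l res_sum_prod ?orbT //.
exact: periodic_tuple_weight.
Qed.

(** Once the box is at least as large as the period, rounding up to whole periods costs only a
    constant factor. *)
Lemma ceil_double_le B P : (P <= B)%N -> ((B.*2 %/ P).+1 * P <= 3 * B)%N.
Proof. by move=> PB; rewrite mulSn; have := leq_trunc_div B.*2 P; lia. Qed.

Lemma cardW_little_o m n K : (3 <= m)%N -> (0 < n)%N ->
  exists H0, forall H, (H0 <= H)%N -> (K * cardW m n H <= H ^ (m * n ^ 2))%N.
Proof.
move=> m_ge3 n_gt0.
(* [C] collects the constants of [q1P] and [q2P] below. The primes are then fixed so that their
   product [E] is at most 1/(K^2 C), and H only has to exceed the product P of these primes. *)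
pose C := ((3 * n ^ m) ^ (n ^ 2) * 3 ^ (m * n ^ 2))%N.
have [] := euler_prod_small (2 ^ n.+1) (K ^ 2 * C); first by rewrite expn_gt0.
move=> ps [ups aps]; set E := \prod_(p <- ps) _ => hE.
exists (\prod_(p <- ps) p)%N => H leH; have := cardW_sqr_bound m n H ps ups aps.
set W := cardW m n H.
move: leH; set P := (\prod_(p <- ps) p)%N => leH hW.
have P_gt0 : (0 < P)%N := prod_primes_gt0 _ aps.
have H_gt0 : (0 < H)%N by exact: leq_trans leH.
move: hW; set q1 := (_ %/ P).+1; set q2 := (_ %/ P).+1 => hW.
have q1P : (q1 * P <= 3 * n ^ m * H ^ m)%N.
  rewrite -mulnA -expnMn; apply: ceil_double_le; apply: leq_trans leH _.
  apply: leq_trans (_ : H ^ m <= _)%N; last by rewrite leq_wexp2r // leq_pmull.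
  by rewrite -{1}[H]expn1 leq_pexp2l // (leq_trans _ m_ge3).
have q2P : (q2 * P <= 3 * H)%N by exact: ceil_double_le.
have E_ge0 : 0 <= E.
  rewrite /E big_seq; apply: prodr_ge0 => p /(allP aps) p_pr.
  by rewrite subr_ge0 invf_le1 ?ler1n ?ltr0n muln_gt0 expn_gt0 (prime_gt0 p_pr).
have hprod : ((\prod_(p <- ps) res_sum (det_weight n p) p)
    * (\prod_(p <- ps) res_sum (tuple_weight m n p) p))%:R
    <= (2 ^ size ps * (P ^ (n ^ 2)) ^ m.+1)%:R * E :> rat.
  rewrite -big_split /= natr_prod.
  apply: le_trans (_ : \prod_(p <- ps) (2 * ((p ^ (n ^ 2)) ^ m.+1)%:R
     * (1 - ((2 ^ n.+1 * p)%:R)^-1)) <= _).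
    rewrite big_seq [leRHS]big_seq; apply: ler_prod => p /(allP aps) p_pr.
    by rewrite ler0n local_factor.
  rewrite !big_split /= -/E le_eqVlt; apply/orP; left; apply/eqP.
  congr (_ * _); rewrite natrM; congr (_ * _).
    by rewrite big_const_seq count_predT iter_mulr_1 natrX.
  rewrite -natr_prod; congr (_%:R).
  have big_expn k : (\prod_(p <- ps) p ^ k = P ^ k)%N.
    by rewrite /P (big_morph _ (fun x y => expnMn x y k) (exp1n k)).
  by under eq_bigr do rewrite -expnM; rewrite big_expn -expnM.
have hW2 : (W ^ 2)%:R <= (C * (H ^ (m * n ^ 2)) ^ 2)%:R * E :> rat.
  have t_gt0 : 0 < (2 ^ size ps)%:R :> rat by rewrite ltr0n expn_gt0.
  rewrite -(ler_pM2r t_gt0) -natrM.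
  rewrite -(ler_nat rat) mulnACA [leRHS]natrM in hW; apply: le_trans hW _.
  apply: le_trans (ler_wpM2l _ hprod) _ => //.
  rewrite mulrA -natrM mulrAC ler_wpM2r // -natrM ler_nat.
  (* The powers of P cancel against the period counts: n^2 for the product matrix and m n^2 for the
     tuple. *)
  apply: leq_trans (_ : (q1 * P) ^ (n ^ 2) * (q2 * P) ^ (m * n ^ 2) * 2 ^ size ps <= _)%N.
    rewrite !expnMn -!expnM mulnS expnD [(m * n ^ 2)%N]mulnC.
    by apply/eq_leq; ring.
  rewrite leq_mul2r; apply/orP; right.
  apply: leq_trans (leq_mul (leq_wexp2r _ _ _ q1P) (leq_wexp2r _ _ _ q2P)) _.
  rewrite /C !expnMn -!expnM muln2 -addnn expnD.
  by apply/eq_leq; ring.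
rewrite -leq_sqr expnMn -(ler_nat rat) natrM.
apply: le_trans (ler_wpM2l _ hW2) _ => //.
rewrite mulrA -natrM mulnA natrM mulrAC -[leRHS]mul1r.
by rewrite ler_wpM2r.
Qed.

End UpperBound.

(** * The lower bound from one full matrix times diagonal matrices *)

Section LowerBound.

Import Order.TTheory GRing.Theory Num.Theory.
Local Open Scope ring_scope.

Lemma prod_word_diag n m (r : 'I_m -> 'rV[int]_n) :
  prod_word (fun l => diag_mx (r l)) = diag_mx (\row_j \prod_(l < m) r l 0 j).
Proof.
elim: m r => [|m IH] r.
  rewrite prod_word0; apply/matrixP => i j; rewrite !mxE big_ord0.
  by case: eqP.
rewrite prod_wordS IH mulmx_diag; congr (diag_mx _).
by apply/rowP => j; rewrite !mxE big_ord_recl.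
Qed.

(** An ordinal d stands for the entry d + 1, which keeps the entries in [1, H]. The integer v has
    code H + v, so an off-diagonal zero has code H. *)
Definition diag_word m n H (t : 'M['I_H]_n * {ffun 'I_m * 'I_n -> 'I_H}) :
    {ffun 'I_m.+1 -> 'M['I_(H.*2.+1)]_n} :=
  [ffun l => if unlift ord0 l is Some l'
    then \matrix_(i, j) inord (H + (if i == j then (t.2 (l', j)).+1 else 0))
    else \matrix_(i, j) inord (H + (t.1 i j).+1)].

Lemma entry_of_inord H k : (k <= H)%N -> @entry_of H (inord (H + k)) = Posz k.
Proof. by move=> kH; rewrite /entry_of inordK; lia. Qed.

Lemma prod_diag_word m n H t i j :
  prod_word (fun l => mat_of (diag_word m n H t l)) i j =
  Posz ((t.1 i j).+1 * \prod_(l < m) (t.2 (l, j)).+1).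
Proof.
rewrite prod_wordS.
have -> : prod_word (fun l => mat_of (diag_word m n H t (lift ord0 l))) =
    prod_word (fun l => diag_mx (\row_j Posz (t.2 (l, j)).+1)).
  rewrite /prod_word; congr foldr; apply: eq_map => l.
  apply/matrixP => a b; rewrite !mxE ffunE liftK mxE.
  rewrite entry_of_inord; last by case: ifP => // _; exact: ltn_ord.
  by case: eqP => [->|].
rewrite prod_word_diag mul_mx_diag !mxE ffunE unlift_none mxE.
rewrite entry_of_inord ?ltn_ord // PoszM; congr (_ * _).
under eq_bigr do rewrite mxE.
by rewrite (big_morph Posz PoszM (erefl (Posz 1))).
Qed.

Lemma card_dvd_ord H N : (0 < N)%N ->
  (#|[pred d : 'I_H | d.+1 %| N]| <= size (divisors N))%N.
Proof.
move=> N_gt0; rewrite cardE -(size_map (fun d : 'I_H => d.+1)).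
apply: uniq_leq_size.
  by rewrite map_inj_uniq ?enum_uniq // => d d' [] /val_inj.
move=> x /mapP[d]; rewrite mem_enum inE => dN ->.
by rewrite -dvdn_divisors.
Qed.

Lemma fiber_diag_word m n H (i0 : 'I_n) M :
  (#|[pred t | prod_word (fun l => mat_of (diag_word m n H t l)) == M]|
   <= \prod_(lj : 'I_m * 'I_n) #|[pred d : 'I_H | d.+1 %| `|M i0 lj.2| ]|)%N.
Proof.
pose F (lj : 'I_m * 'I_n) := [pred d : 'I_H | d.+1 %| `|M i0 lj.2| ]%N.
have -> : (\prod_(lj : 'I_m * 'I_n) #|[pred d : 'I_H | d.+1 %| `|M i0 lj.2| ]|
    = #|family F|)%N.
  by rewrite card_family foldrE big_map big_enum.
set A := [pred t | _].
(* Within a fibre the diagonal parts determine A: column j of the product is column j of A times a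
   known positive integer. *)
have inj2 : {in A &, injective (fun t => t.2)}.
  move=> [a d] [a' d']; rewrite !inE /= => /eqP h /eqP h' dd; rewrite dd in h *.
  congr (_, _); apply/matrixP => i j; apply: val_inj => /=.
  have := prod_diag_word m n H (a, d') i j; rewrite h -h' prod_diag_word /=.
  move=> [] /eqP; rewrite eqn_pmul2r; last exact: prodn_gt0.
  by rewrite eqSS => /eqP.
rewrite -(card_in_image inj2); apply: subset_leq_card; apply/subsetP => d.
case/imageP => t; rewrite inE => /eqP tM ->; apply/familyP => -[l j].
rewrite inE /= -tM prod_diag_word /= dvdn_mull //.
by rewrite (bigD1 l) //= dvdn_mulr.
Qed.

Lemma card_le_fiber (T : finType) (S : eqType) (s : seq S) (g : T -> S) F :
  (forall t, g t \in s) -> (forall M, #|[pred t | g t == M]| <= F)%N ->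
  (#|T| <= size (undup s) * F)%N.
Proof.
move=> gs fib; rewrite -sum1_card.
have -> : (\sum_(t : T) 1 = \sum_(t : T) \sum_(M <- undup s | g t == M) 1)%N.
  apply: eq_bigr => t _; rewrite sum1_count (eq_count (a2 := pred1 (g t))).
    by rewrite count_uniq_mem ?undup_uniq // mem_undup gs.
  by move=> M /=; rewrite eq_sym.
rewrite (exchange_big_dep predT) //=.
apply: leq_trans (_ : \sum_(M <- undup s) F <= _)%N.
  by apply: leq_sum => M _; rewrite sum1_card; exact: fib.
by rewrite big_const_seq count_predT iter_addn_0 mulnC.
Qed.

(** Here [m] counts the diagonal factors. An entry in row 0 of the product is at most [H ^ m.+1],
    and the divisor bound is applied to it once for each of the mn diagonal entries. *)
Lemma cardW_lower m n k : (0 < n)%N -> (0 < k)%N ->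
  exists2 C, (0 < C)%N & forall H, (0 < H)%N ->
  ((H ^ (n ^ 2 + m * n)) ^ k <=
    cardW m.+1 n H ^ k * (C * H ^ m.+1) ^ (m * n))%N.
Proof.
case: n => // n _ k_gt0; have [C C_gt0 hC] := divisor_bound k k_gt0.
exists C => // H H_gt0.
pose T := ('M['I_H]_n.+1 * {ffun 'I_m * 'I_n.+1 -> 'I_H})%type.
pose g (t : T) := prod_word (fun l => mat_of (diag_word m n.+1 H t l)).
pose fib M := #|[pred t : T | g t == M]|.
pose X := ((C * H ^ m.+1) ^ (m * n.+1))%N.
have fibX M : (fib M ^ k <= X)%N.
  case: (pickP [pred t : T | g t == M]) => [t0 /eqP t0M|h0]; last first.
    by rewrite /fib (eq_card0 h0) exp0n.
  apply: leq_trans (leq_wexp2r _ _ _ (fiber_diag_word m n.+1 H ord0 M)) _.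
  rewrite (big_morph _ (fun x y => expnMn x y k) (exp1n k)).
  have -> : X = (\prod_(lj : 'I_m * 'I_n.+1) (C * H ^ m.+1))%N.
    by rewrite prod_nat_const card_prod !card_ord.
  apply: leq_prod => -[l j] _ /=; rewrite -t0M /g prod_diag_word /=.
  set N := (_ * _)%N; have N_gt0 : (0 < N)%N by rewrite muln_gt0 prodn_gt0.
  apply: leq_trans (leq_wexp2r _ _ _ (card_dvd_ord H N N_gt0)) _.
  apply: leq_trans (hC N N_gt0) _; rewrite leq_mul2l; apply/orP; right.
  rewrite expnS; apply: leq_mul; first exact: ltn_ord.
  rewrite -[X in (_ <= _ ^ X)%N]card_ord -prod_nat_const.
  by apply: leq_prod => l' _; exact: ltn_ord.
(* The fibres are controlled only through their k-th powers; their maximum serves as one integer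
   bound for the double counting. *)
pose F := (\max_(u : seq_sub (undup (words m.+1 n.+1 H))) fib (val u))%N.
have FX : (F ^ k <= X)%N.
  rewrite /F; elim/big_ind: _ => [|x y hx hy|u _]; first by rewrite exp0n.
    by case: (leqP x y).
  exact: fibX.
have g_in t : g t \in words m.+1 n.+1 H by apply: image_f.
have fibF M : (fib M <= F)%N.
  case: (pickP [pred t : T | g t == M]) => [t0 /eqP t0M|h0]; last first.
    by rewrite /fib (eq_card0 h0).
  have M_in : M \in undup (words m.+1 n.+1 H) by rewrite mem_undup -t0M.
  exact: (leq_bigmax (SeqSub M_in)).
have := card_le_fiber _ _ _ g F g_in fibF.
rewrite card_prod card_ffun card_mx !card_prod !card_ord -expnD mulnn -/(cardW _ _ _).
move=> /(leq_wexp2r k) /leq_trans; apply.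
by rewrite expnMn leq_mul2l FX orbT.
Qed.

End LowerBound.

(** * From integer inequalities to real exponents *)

Section RealBounds.

Local Open Scope R_scope.

Lemma INR_expn a b : INR (a ^ b)%N = INR a ^ b.
Proof. by elim: b => [|b IH] //=; rewrite expnS -multE mult_INR IH. Qed.

Lemma INR_leq a b : (a <= b)%N -> INR a <= INR b.
Proof. by move/leP; exact: le_INR. Qed.

Lemma nat_above (x : R) : exists k : nat, (0 < k)%N /\ x <= INR k.
Proof.
have [k hk] := INR_unbounded x; exists k.+1; split=> //.
by rewrite S_INR; Lra.lra.
Qed.

Lemma ln_le x y : 0 < x -> x <= y -> ln x <= ln y.
Proof.
by move=> x_gt0 [/(ln_increasing _ _ x_gt0)/Rlt_le //|->]; exact: Rle_refl.
Qed.

(** Taking logarithms and using C <= H gives (kE - L - 1) ln H <= k ln W; division by k loses (L +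
    1)/k <= eps in the exponent. *)
Lemma Rpower_le_of_pow (H W C E L k : nat) (eps : R) :
  (0 < H)%N -> (0 < k)%N -> (C <= H)%N -> INR L + 1 <= INR k * eps ->
  ((H ^ E) ^ k <= W ^ k * (C * H ^ L))%N ->
  Rpower (INR H) (INR E - eps) <= INR W.
Proof.
move=> H_gt0 k_gt0 leCH keps hle.
have pos a : (0 < a)%N -> 0 < INR a by move=> ?; apply: lt_0_INR; apply/ltP.
have : (0 < W ^ k * (C * H ^ L))%N by apply: leq_trans hle; rewrite !expn_gt0 H_gt0.
rewrite !muln_gt0 => /and3P[Wk_gt0 C_gt0 _].
have W_gt0 : (0 < W)%N by move: Wk_gt0; rewrite expn_gt0; case: (W) k_gt0 => [|//]; case: (k).
have := INR_leq _ _ hle; rewrite -multE !mult_INR !INR_expn.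
have HR := pos H H_gt0; have WR := pos W W_gt0; have CR := pos C C_gt0.
have kR := pos k k_gt0.
move=> hR; have : ln ((INR H ^ E) ^ k) <= ln (INR W ^ k * (INR C * INR H ^ L)).
  by apply: ln_le => //; do 2 apply: pow_lt.
rewrite !ln_mult ?ln_pow //; try (by apply: pow_lt);
  try (by apply: Rmult_lt_0_compat => //; apply: pow_lt).
move=> hln.
have lnC : ln (INR C) <= ln (INR H) by apply: ln_le => //; exact: INR_leq.
have lnH : 0 <= ln (INR H).
  by rewrite -ln_1; apply: ln_le; [Lra.lra | apply: (INR_leq 1)].
rewrite /Rpower -[X in _ <= X](exp_ln _ WR).
suff hsuff : (INR E - eps) * ln (INR H) <= ln (INR W).
  by case: hsuff => [/exp_increasing/Rlt_le //|->]; exact: Rle_refl.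
apply: (Rmult_le_reg_l (INR k)) => //.
have : (INR L + 1) * ln (INR H) <= INR k * eps * ln (INR H).
  exact: Rmult_le_compat_r.
Lra.nra.
Qed.

End RealBounds.

(** * Choice of the parameters for a given [eps] *)

Theorem theorem2p3 (m n : nat) (hm : (2 <= m)%N) (hn : (2 <= n)%N) :
  (forall eps : R, Rlt R0 eps -> exists H0 : nat, forall H : nat, (H0 <= H)%N ->
     Rle (Rpower (INR H) (Rminus (INR (n ^ 2 + m * n - n)) eps))
         (INR (cardW m n H)))
  /\
  ((6 <= m)%N -> forall eps : R, Rlt R0 eps -> exists H0 : nat, forall H : nat,
     (H0 <= H)%N ->
     Rle (INR (cardW m n H)) (Rmult eps (pow (INR H) (m * n ^ 2)))).
Proof.
have n_gt0 : (0 < n)%N by exact: ltnW.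
split=> [eps eps_gt0|m_ge6 eps eps_gt0].
  case: m hm => // m _.
  have -> : (n ^ 2 + m.+1 * n - n = n ^ 2 + m * n)%N by rewrite mulSn addnCA addKn.
  (* The fibre bound is C^(mn) H^L with L = (m+1)mn; k makes (L + 1)/k at most [eps], and H >=
     C^(mn) absorbs the constant into one more power of H. *)
  have [k [k_gt0 hk]] := nat_above (Rdiv (INR (m.+1 * (m * n)) + 1) eps).
  have [C C_gt0 hC] := cardW_lower m n k n_gt0 k_gt0.
  exists (C ^ (m * n))%N => H leH.
  have H_gt0 : (0 < H)%N by apply: leq_trans leH; rewrite expn_gt0 C_gt0.
  apply: (Rpower_le_of_pow _ _ _ _ (m.+1 * (m * n)) _ _ H_gt0 k_gt0 leH); last first.
    by have := hC H H_gt0; rewrite expnMn -[((H ^ m.+1) ^ _)%N]expnM.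
  have epsN0 : eps <> R0 by move=> e0; move: eps_gt0; rewrite e0; exact: Rlt_irrefl.
  apply: (Rmult_le_reg_r (Rinv eps)); first exact: Rinv_0_lt_compat.
  by rewrite Rmult_assoc Rinv_r // Rmult_1_r.
(* Saving a factor K >= 1/eps gives the bound with constant [eps]. *)
have [K [K_gt0 hK]] := nat_above (Rinv eps).
have m_ge3 : (3 <= m)%N by exact: leq_trans m_ge6.
have [H0 hH0] := cardW_little_o m n K m_ge3 n_gt0.
exists H0 => H /hH0 /INR_leq; rewrite -multE mult_INR INR_expn => hW.
apply: (Rmult_le_reg_l (Rinv eps)); first exact: Rinv_0_lt_compat.
have epsN0 : eps <> R0 by move=> e0; move: eps_gt0; rewrite e0; exact: Rlt_irrefl.
rewrite -Rmult_assoc Rinv_l // Rmult_1_l; apply: Rle_trans hW.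
by apply: Rmult_le_compat_r => //; exact: pos_INR.
Qed.
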